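(* Let $n\ge1$, and let $x=(x_i)_{i\in I}$ and $y=(y_j)_{j\in J}$ be probability distributions on totally ordered sets $I$ and $J$. Suppose that a permutation $u\in\mathfrak{S}_n$ is chosen from the QS$(x)$-distribution and, independently, a permutation $v\in\mathfrak{S}_n$ is chosen from the QS$(y)$-distribution. Let $w\in\mathfrak{S}_n$. Then the probability that $uv=w$ is equal to $L_{\mathrm{co}(w^{-1})}(xy)$. In other words, if $*$ denotes convolution, then $$\mathrm{QS}(x)*\mathrm{QS}(y)=\mathrm{QS}(xy).$$ Equivalently, in the group algebra $\mathbb{R}\mathfrak{S}_n$ we have $$\Gamma_n(x)\,\Gamma_n(y)=\Gamma_n(xy).$$
   Context: A probability distribution on a totally ordered set $I$ is a family $x=(x_i)_{i\in I}$ with $x_i\ge0$ and $\sum_i x_i=1$. Product convention: $(uv)(k)=u(v(k))$. QS$(x)$-distribution on $\mathfrak{S}_n$: choose $i_1,\dots,i_n\in I$ independently from $x$ and take the standardization $w$ of $i_1\cdots i_n$. That is, if $\alpha_1<\cdots<\alpha_k$ are the elements of $I$ that actually appear and $\alpha_r$ appears $a_r$ times, replace the $\alpha_1$'s by $1,\dots,a_1$ from left to right, then the $\alpha_2$'s by $a_1+1,\dots,a_1+a_2$ from left to right, etc. $xy$ denotes the family $(x_iy_j)_{(i,j)\in I\times J}$, where $I\times J$ has the lexicographic order: $(i,j)<(r,s)$ if $i<r$, or $i=r$ and $j<s$. For $w=w_1\cdots w_n$, $D(w)=\{i: w_i>w_{i+1}\}$. For a composition $\alpha=(\alpha_1,\dots,\alpha_k)$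 of $n$, $S_\alpha=\{\alpha_1,\alpha_1+\alpha_2,\dots,\alpha_1+\cdots+\alpha_{k-1}\}$; $\mathrm{co}(w)$ is the unique composition of $n$ with $S_{\mathrm{co}(w)}=D(w)$. $L_\alpha(x)=\sum x_{i_1}\cdots x_{i_n}$ over all $i_1\le\cdots\le i_n$ in $I$ with $i_j<i_{j+1}$ whenever $j\in S_\alpha$ (absolutely convergent). $\Gamma_n(x)=\sum_{w\in\mathfrak{S}_n}L_{\mathrm{co}(w^{-1})}(x)\,w\in\mathbb{R}\mathfrak{S}_n$. *)

(* Defs.v *)
From HB Require Import structures.
From mathcomp Require Import all_boot all_order all_algebra all_fingroup.
From mathcomp Require Import all_classical all_reals all_analysis.

Set Implicit Arguments.
Unset Strict Implicit.
Unset Printing Implicit Defensive.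

Import Order.TTheory GRing.Theory Num.Theory.
Local Open Scope classical_set_scope.
Local Open Scope ring_scope.

Definition prob_distr (R : realType) (I : choiceType) (x : I -> R) : Prop :=
  (forall i, 0 <= x i) /\ (\esum_(i in [set: I]) (x i)%:E = 1)%E.

(* [I *l J] is [I * J] with the lexicographic order. *)
Definition distr_mul (R : realType) d1 (I : orderType d1)
    d2 (J : orderType d2) (x : I -> R) (y : J -> R) : I *l J -> R :=
  fun p => x p.1 * y p.2.

(* The product (uv)(k) = u (v k).  MathComp's [*%g] on permutations composes
   in the opposite order: (v * u)%g k = u (v k). *)
Definition pmul n (u v : 'S_n) : 'S_n := (v * u)%g.

Lemma pmulE n (u v : 'S_n) k : pmul u v k = u (v k).
Proof. exact: permM. Qed.

Section Standardization.
Variables (d : Order.disp_t) (I : orderType d) (n : nat) (t : n.-tuple I).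

(* If position [k] carries the m-th occurrence, from left to right, of the
   r-th smallest letter, its label is a_1 + ... + a_(r-1) + m, or one less
   with 0-based labels: the number of positions carrying a smaller letter, or
   the same letter further to the left. *)
Definition std_before (k : 'I_n) : {set 'I_n} :=
  [set j | (tnth t j < tnth t k)%O || ((tnth t j == tnth t k) && (j < k)%N)].

Lemma std_subproof (k : 'I_n) : (#|std_before k| < n)%N.
Proof.
rewrite -[X in (_ < X)%N]card_ord -cardsT; apply: proper_card.
by apply/properP; split; [exact: finset.subsetT | exists k; rewrite !inE // ltxx eqxx ltnn].
Qed.

Definition std_fun (k : 'I_n) : 'I_n := Ordinal (std_subproof k).

Lemma std_before_lt (j k : 'I_n) :
  j \in std_before k -> (#|std_before j| < #|std_before k|)%N.
Proof.
move=> jk; apply: proper_card; apply/properP; split; last first.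
  by exists j => //; rewrite inE ltxx eqxx ltnn.
apply/fintype.subsetP => i; move: jk; rewrite !inE.
case/orP=> [jk|/andP[/eqP jk ljk]] /orP[ij|/andP[/eqP ij lij]].
- by rewrite (lt_trans ij jk).
- by rewrite ij jk.
- by rewrite -jk ij.
- by rewrite ij jk eqxx (ltn_trans lij ljk) orbT.
Qed.

Lemma std_fun_inj : injective std_fun.
Proof.
move=> j k /(congr1 val) /= jk; apply/eqP; apply/negPn/negP => njk.
have: (j \in std_before k) || (k \in std_before j).
  by rewrite !inE; case: ltgtP => //= _; move: njk; rewrite -val_eqE /= neq_ltn.
by case/orP => /std_before_lt; rewrite jk ltnn.
Qed.

Definition std : 'S_n := perm std_fun_inj.

End Standardization.

(* The QS(x)-distribution as a mass function: the total mass, under the product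
   distribution on words i_1 ... i_n, of the words whose standardization is
   [w]. *)
Definition QS (R : realType) d (I : orderType d) n (x : I -> R) (w : 'S_n) :
    \bar R :=
  (\esum_(t in [set t : n.-tuple I | std t = w]) (\prod_(k < n) x (tnth t k))%:E)%E.

Definition is_comp n (a : seq nat) : bool := all (ltn 0) a && (sumn a == n).
Definition compn n := {a : seq nat | is_comp n a}.

(* {a_1, a_1 + a_2, ..., a_1 + ... + a_(k-1)} *)
Definition comp_set n (a : compn n) : seq nat :=
  take (size (val a)).-1 (scanl addn 0%N (val a)).

Section Descents.
Variables (n : nat) (w : 'S_n).

(* Positions are 1-based, as in w = w_1 ... w_n. *)
Definition word : seq nat := [seq (nat_of_ord (w k)).+1 | k <- enum 'I_n].
Definition letter (i : nat) : nat := nth 0%N word i.-1.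
Definition Des : seq nat := [seq i <- iota 1 n.-1 | (letter i > letter i.+1)%N].

(* The parts of co(w) are the gaps between consecutive elements of
   {0} \cup D(w) \cup {n}. *)
Definition co_ends : seq nat := [seq i <- iota 1 n | (i == n) || (i \in Des)].
Definition co_seq : seq nat := pairmap (fun a b => b - a)%N 0%N co_ends.

Lemma co_ends_path : path ltn 0%N co_ends.
Proof.
have : path ltn 0%N (iota 1 n) := iota_ltn_sorted 0 n.+1.
by apply: subseq_path; [exact: ltn_trans | exact: filter_subseq].
Qed.

Lemma pairmap_subnP a s : path ltn a s ->
  let p := pairmap (fun a b => b - a)%N a s in
  all (ltn 0) p /\ scanl addn a p = s.
Proof.
elim: s a => [//|b s IH] a /= /andP[ab /IH[H1 H2]].
by rewrite subn_gt0 ab H1 subnKC ?(ltnW ab) // H2.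
Qed.

Lemma last_scanl_addn a s : last a (scanl addn a s) = (a + sumn s)%N.
Proof. by elim: s a => [|b s IH] a /=; rewrite ?addn0 // IH addnA. Qed.

Lemma mem_Des i : (i \in Des) = (0 < i < n)%N && (letter i > letter i.+1)%N.
Proof.
rewrite mem_filter mem_iota andbC add1n; case: n => [|m] //=.
by case: i.
Qed.

Lemma co_endsE : (0 < n)%N -> co_ends = rcons Des n.
Proof.
move=> n0; rewrite /co_ends.
have -> : iota 1 n = rcons (iota 1 n.-1) n.
  by case: n n0 => // m _; rewrite -[X in iota _ X = _]addn1 iotaD /= add1n cats1.
rewrite filter_rcons eqxx /=; congr rcons.
rewrite {2}/Des; apply: eq_in_filter => i; rewrite mem_iota add1n => /andP[i0].
rewrite prednK // => i_n; rewrite (ltn_eqF i_n) /= mem_Des i0 i_n //.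
Qed.

Lemma co_subproof : is_comp n co_seq.
Proof.
have [H1 H2] := pairmap_subnP co_ends_path.
rewrite /is_comp H1 /= -[sumn _]add0n -last_scanl_addn H2.
have [n0|] := posnP n; last by move=> /co_endsE->; rewrite last_rcons.
by rewrite /co_ends n0.
Qed.

Definition co : compn n := exist _ co_seq co_subproof.

End Descents.

(* [co w] is the unique composition of [n] whose set is D(w). *)
Lemma comp_set_co n (w : 'S_n) : (0 < n)%N -> comp_set (co w) = Des w.
Proof.
move=> n0; rewrite /comp_set /= size_pairmap.
have [_ ->] := pairmap_subnP (co_ends_path w).
by rewrite co_endsE // size_rcons -cats1 take_size_cat.
Qed.

Lemma comp_scanl n (a : compn n) : (0 < n)%N ->
  scanl addn 0%N (val a) = rcons (comp_set a) n.
Proof.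
move=> n0; case: a => a; rewrite /comp_set /= => /andP[_ /eqP an].
have := last_scanl_addn 0 a; rewrite add0n an.
have : size (scanl addn 0%N a) = size a by rewrite size_scanl.
case/lastP: (scanl addn 0%N a) => [|s z].
  by move=> _ /= n0'; move: n0; rewrite -n0'.
rewrite size_rcons last_rcons => <- -> /=; congr rcons.
by rewrite -cats1 take_size_cat.
Qed.

Lemma comp_set_path n (a : compn n) : (0 < n)%N -> path ltn 0%N (rcons (comp_set a) n).
Proof.
move=> n0; rewrite -comp_scanl //; case: a => a /= /andP[+ _].
elim: a {1 2}0%N => [//|b a IH] k /= /andP[b0 /IH->].
by rewrite -[X in (X < _)%N]addn0 ltn_add2l b0.
Qed.

Lemma co_unique n (w : 'S_n) (a : compn n) : (0 < n)%N ->
  comp_set a =i Des w -> a = co w.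
Proof.
move=> n0 aw; have s_set (b : compn n) : sorted ltn (comp_set b).
  have := comp_set_path b n0; rewrite rcons_path => /andP[+ _].
  exact: path_sorted.
have E : comp_set a = comp_set (co w).
  apply: (irr_sorted_eq ltn_trans ltnn) => // i.
  by rewrite aw comp_set_co.
have /(congr1 (pairmap (fun a b => b - a)%N 0%N)) :
    scanl addn 0%N (val a) = scanl addn 0%N (val (co w)).
  by rewrite !comp_scanl // E.
rewrite !(@scanlK _ _ (fun a b => b - a)%N addn) => [/val_inj //||] i j;
  by rewrite addKn.
Qed.

(* Words i_1 <= ... <= i_n with i_j < i_(j+1) for j in S_alpha; the 1-based
   position j corresponds to the index j - 1 of the tuple. *)
Definition L_words d (I : orderType d) n (a : compn n) : set (n.-tuple I) :=
  [set t | (forall j k : 'I_n, (j <= k)%N -> (tnth t j <= tnth t k)%O) /\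
           (forall j k : 'I_n, k = j.+1 :> nat -> j.+1 \in comp_set a ->
              (tnth t j < tnth t k)%O)].

Arguments L_words {d} I {n} a.

Definition Lsum (R : realType) d (I : orderType d) n (a : compn n) (x : I -> R) :
    \bar R :=
  (\esum_(t in L_words I a) (\prod_(k < n) x (tnth t k))%:E)%E.

(* Convolution of mass functions: the law of [pmul u v]. *)
Definition perm_conv (R : realType) n (f g : 'S_n -> \bar R) (w : 'S_n) : \bar R :=
  (\sum_(p : 'S_n * 'S_n | pmul p.1 p.2 == w) f p.1 * g p.2)%E.

(* The group algebra of 'S_n, as functions 'S_n -> R with the convolution
   product induced by [pmul]; this is a copy of [{ffun 'S_n -> R}] because the
   latter already carries the pointwise product. *)
Definition galg (R : comNzRingType) (n : nat) : Type := {ffun 'S_n -> R}.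

Section GroupAlgebra.
Variables (R : comNzRingType) (n : nat).
Local Notation A := (galg R n).

HB.instance Definition _ := GRing.Lmodule.copy A {ffun 'S_n -> R^o}.

Definition gbasis (w : 'S_n) : A := [ffun v => (v == w)%:R].

Definition galg_mul (f g : A) : A :=
  [ffun w => \sum_(p : 'S_n * 'S_n | pmul p.1 p.2 == w) f p.1 * g p.2].

Lemma galg_mulEl (f g : A) w :
  galg_mul f g w = \sum_(u : 'S_n) f u * g (w * u^-1)%g.
Proof.
rewrite ffunE (reindex (fun u : 'S_n => (u, (w * u^-1)%g))) /=.
  by apply: eq_bigl => u; rewrite /pmul mulgKV eqxx.
exists fst => [u _ //|[u v]]; rewrite inE /pmul /= => /eqP <-.
by rewrite mulgK.
Qed.

Lemma galg_mulA : associative galg_mul.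
Proof.
move=> f g h; apply/ffunP => w; rewrite !galg_mulEl.
under eq_bigr do rewrite galg_mulEl mulr_sumr.
under [RHS]eq_bigr do rewrite galg_mulEl mulr_suml.
rewrite [RHS]exchange_big /=; apply: eq_bigr => u _.
rewrite [RHS](reindex_inj (mulIg u)) /=; apply: eq_bigr => v _.
by rewrite mulgK invMg !mulgA mulrA.
Qed.

Lemma galg_mul1l : left_id (gbasis 1%g) galg_mul.
Proof.
move=> f; apply/ffunP => w; rewrite galg_mulEl (bigD1 1%g) //= ffunE eqxx mul1r.
by rewrite invg1 mulg1 big1 ?addr0 // => u /negPf u1; rewrite ffunE u1 mul0r.
Qed.

Lemma galg_mul1r : right_id (gbasis 1%g) galg_mul.
Proof.
move=> f; apply/ffunP => w; rewrite galg_mulEl (bigD1 w) //= ffunE mulgV eqxx.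
rewrite mulr1 big1 ?addr0 // => u uw.
by rewrite ffunE -eq_mulgV1 eq_sym (negPf uw) mulr0.
Qed.

Lemma galg_mulDl : left_distributive galg_mul +%R.
Proof.
move=> f g h; apply/ffunP => w; rewrite [RHS]ffunE !galg_mulEl -big_split.
by apply: eq_bigr => u _; rewrite ffunE mulrDl.
Qed.

Lemma galg_mulDr : right_distributive galg_mul +%R.
Proof.
move=> f g h; apply/ffunP => w; rewrite [RHS]ffunE !galg_mulEl -big_split.
by apply: eq_bigr => u _; rewrite ffunE mulrDr.
Qed.

Lemma galg_1_neq0 : gbasis 1%g != 0.
Proof.
by apply/eqP => /ffunP /(_ 1%g); rewrite !ffunE eqxx => /eqP; rewrite oner_eq0.
Qed.

HB.instance Definition _ := GRing.Zmodule_isNzRing.Build A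
  galg_mulA galg_mul1l galg_mul1r galg_mulDl galg_mulDr galg_1_neq0.

Lemma galg_scaleAl (a : R) (f g : A) : a *: (f * g) = (a *: f) * g.
Proof.
apply/ffunP => w; rewrite [LHS]ffunE !galg_mulEl scaler_sumr.
by apply: eq_bigr => u _; rewrite ffunE scalerAl.
Qed.

Lemma galg_scaleAr (a : R) (f g : A) : a *: (f * g) = f * (a *: g).
Proof.
apply/ffunP => w; rewrite [LHS]ffunE !galg_mulEl scaler_sumr.
by apply: eq_bigr => u _; rewrite ffunE scalerAr.
Qed.

HB.instance Definition _ := GRing.Lmodule_isLalgebra.Build R A galg_scaleAl.
HB.instance Definition _ := GRing.Lalgebra_isAlgebra.Build R A galg_scaleAr.

Lemma gbasisM (u v : 'S_n) : gbasis u * gbasis v = gbasis (pmul u v).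
Proof.
apply/ffunP => w; rewrite galg_mulEl (bigD1 u) //= !ffunE eqxx mul1r.
rewrite big1 ?addr0 => [|u' /negPf nu]; last by rewrite ffunE nu mul0r.
by rewrite /pmul -(inj_eq (mulIg u)) mulgKV.
Qed.

End GroupAlgebra.

(* [Lsum] is extended-real-valued; for the probability distributions considered
   it is finite, and [fine] is its real value. *)
Definition Gamma (R : realType) d (I : orderType d) (n : nat) (x : I -> R) :
    galg R n :=
  \sum_(w : 'S_n) fine (Lsum (co (w^-1)%g) x) *: gbasis R w.

(* 'S_n carries the discrete sigma-algebra. *)
Section RandomPermutations.
Variables (R : realType) (d : measure_display) (T : measurableType d).
Variables (P : probability T R) (n : nat).

Definition random_perm (U : T -> 'S_n) : Prop :=
  forall A : set 'S_n, measurable (U @^-1` A).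

Definition has_law (U : T -> 'S_n) (q : 'S_n -> \bar R) : Prop :=
  forall w, P (U @^-1` [set w]) = q w.

Definition independent_perms (U V : T -> 'S_n) : Prop :=
  forall A B : set 'S_n,
    (P (U @^-1` A `&` V @^-1` B) = P (U @^-1` A) * P (V @^-1` B))%E.

End RandomPermutations.

(* Main.v *)
(* std t = w says that w orders the positions k as the pairs (t_k, k) do
   lexicographically, i.e. that s = t o w^-1 is weakly increasing, and strictly
   so at the descents of w^-1; hence QS(x)(w) = L_(co(w^-1))(x).
   For the convolution, put v = std b and a = a' o v: ordering positions by
   (a_k, b_k, k) is ordering them by (a_k, v k), so std(a, b) = (std a') v.  As
   (a', b) |-> (a, b) is a weight-preserving bijection, summing over all pairs
   with std(a') std(b) = w gives QS(x) * QS(y) = QS(xy). *)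
Require Import Defs.
From HB Require Import structures.
From mathcomp Require Import all_boot all_order all_algebra all_fingroup.
From mathcomp Require Import all_classical all_reals all_analysis.
Import Order.TTheory GRing.Theory Num.Theory.
Local Open Scope classical_set_scope.
Local Open Scope ring_scope.

Set Implicit Arguments.
Unset Strict Implicit.

(** * Permutations compared through the order of their values *)

Lemma card_perm_lt n (u : 'S_n) (k : 'I_n) :
  #|[set j | (u j < u k)%N]%SET| = u k.
Proof.
have -> : [set j | (u j < u k)%N]%SET = u @^-1: [set i : 'I_n | (i < u k)%N]%SET.
  by apply/setP => j; rewrite !inE.
rewrite card_preimset; last exact: perm_inj.
have -> : [set i : 'I_n | (i < u k)%N]%SET =
    widen_ord (ltnW (ltn_ord (u k))) @: [set: 'I_(u k)]%SET.
  apply/setP => i; rewrite !inE.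
  apply/idP/imsetP => [ik|[j _ ->]]; last exact: (ltn_ord j).
  by exists (Ordinal ik) => //; apply: val_inj.
rewrite card_imset ?cardsT ?card_ord //.
by move=> i j /(congr1 val) /= ij; apply: val_inj.
Qed.

(** The value [u k] counts the positions carrying a smaller value, so the relative order of the
    values determines [u]; as that order is total, one implication suffices. *)
Lemma eq_perm_homo n (u v : 'S_n) :
  (forall j k, (v j < v k)%N -> (u j < u k)%N) -> u = v.
Proof.
move=> vu; apply/permP => k; apply: val_inj => /=.
rewrite -[LHS]card_perm_lt -[RHS]card_perm_lt; congr #|pred_of_set _|.
apply/setP => j; rewrite !inE; apply/idP/idP => [|/vu//].
case: (ltngtP (v j) (v k)) => [//|/vu|/val_inj/perm_inj ->]; last by rewrite ltnn.
by move=> /ltnW; rewrite leqNgt => /negbTE ->.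
Qed.

(** Right to left is [std_before_lt]; the converse holds because the pairs [(t_k, k)] are totally
    ordered, so one of two distinct positions always precedes the other. *)
Lemma std_ltE d (I : orderType d) n (t : n.-tuple I) (j k : 'I_n) :
  (std t j < std t k)%N =
  (tnth t j < tnth t k)%O || ((tnth t j == tnth t k) && (j < k)%N).
Proof.
have lt_std i l : i \in std_before t l -> (std t i < std t l)%N.
  by rewrite !permE /=; exact: std_before_lt.
apply/idP/idP => [|jk]; last by apply: lt_std; rewrite inE.
apply: contraTT; rewrite negb_or negb_and -!leNgt -leqNgt.
have [->|jk] := eqVneq j k; first by rewrite ltnn.
move=> /andP[tjk]; case: ltgtP tjk => //= tkj _ h;
  rewrite -leqNgt ltnW //; apply: lt_std; rewrite inE.
  by rewrite tkj.
by rewrite tkj eqxx orbC ltn_neqAle h -val_eqE eq_sym in jk *; rewrite jk.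
Qed.

(* [letter] is 1-based, hence the shifts on both sides. *)
Lemma letterE n (v : 'S_n) (j : 'I_n) : letter v j.+1 = (v j).+1.
Proof.
rewrite /letter /word /= (nth_map j) ?size_enum_ord //.
by rewrite nth_ord_enum.
Qed.

Lemma mem_comp_set_co n (v : 'S_n) (j k : 'I_n) : k = j.+1 :> nat ->
  (j.+1 \in comp_set (co v)) = (v k < v j)%N.
Proof.
move=> kj; have n0 : (0 < n)%N by case: n j {v k kj} => [[]|].
have lk : letter v k = (v j).+1 by rewrite kj letterE.
by rewrite comp_set_co // mem_Des -kj lk letterE ltn_ord {1}kj.
Qed.

(** * Standardization classes and the words counted by [L] *)

Definition word_act d (I : orderType d) n (w : 'S_n) (t : n.-tuple I) :
  n.-tuple I := [tuple tnth t (w k) | k < n].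

Lemma word_actK d (I : orderType d) n (w : 'S_n) :
  cancel (@word_act d I n w) (word_act w^-1).
Proof. by move=> t; apply: eq_from_tnth => k; rewrite !tnth_mktuple permKV. Qed.

Lemma word_actKV d (I : orderType d) n (w : 'S_n) :
  cancel (@word_act d I n w^-1) (word_act w).
Proof. by move=> t; apply: eq_from_tnth => k; rewrite !tnth_mktuple permK. Qed.

(** Equal adjacent letters are excluded at a descent of [v], so a tie there means that [v]
    increases. Transitivity of the lexicographic order on pairs (letter, value of [v]) then reaches
    all [a < b]. *)
Lemma L_words_lt d (I : orderType d) n (v : 'S_n) (s : n.-tuple I) :
  L_words I (co v) s -> forall a b : 'I_n, (a < b)%N ->
  (tnth s a < tnth s b)%O || ((tnth s a == tnth s b) && (v a < v b)%N).
Proof.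
move=> [s_le s_lt].
have adj (a b : 'I_n) : b = a.+1 :> nat ->
    (tnth s a < tnth s b)%O || ((tnth s a == tnth s b) && (v a < v b)%N).
  move=> ba; have := s_le a b; rewrite ba leqnSn => /(_ isT).
  rewrite le_eqVlt => /orP[/eqP sab|->//].
  rewrite sab eqxx ltxx /= ltnNge leq_eqVlt.
  apply/negP => /orP[/eqP/val_inj/perm_inj ab|].
    by move/eqP: ba; rewrite ab ltn_eqF.
  by rewrite -(mem_comp_set_co v ba) => /(s_lt _ _ ba); rewrite sab ltxx.
(* Induction on the gap [m = b - a - 1], with adjacent positions as base case. *)
move=> a b ab; have [m] : exists m, b = (a + m).+1 :> nat.
  by exists (b - a.+1)%N; rewrite -addSn subnKC.
elim: m b {ab} => [|m IH] b bE; first by apply: adj; rewrite bE addn0.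
have cn : ((a + m).+1 < n)%N by rewrite (ltn_trans _ (ltn_ord b)) // bE addnS.
have := IH (Ordinal cn) erefl; set c := Ordinal cn => ac.
have cb : (tnth s c < tnth s b)%O || ((tnth s c == tnth s b) && (v c < v b)%N).
  by apply: adj; rewrite bE addnS.
case/orP: ac cb => [ac|/andP[/eqP-> ac]] /orP[cb|/andP[/eqP<- cb]].
- by rewrite (lt_trans ac cb).
- by rewrite ac.
- by rewrite cb.
- by rewrite eqxx (ltn_trans ac cb) orbT.
Qed.

Lemma std_L_words d (I : orderType d) n (w : 'S_n) (s : n.-tuple I) :
  std (word_act w s) = w <-> L_words I (co w^-1) s.
Proof.
split=> [sw|sL].
  have lt_s (a b : 'I_n) : (a < b)%N ->
      (tnth s a < tnth s b)%O || ((tnth s a == tnth s b) && (w^-1%g a < w^-1%g b)%N).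
    move=> ab; have := std_ltE (word_act w s) (w^-1%g a) (w^-1%g b).
    by rewrite sw !tnth_mktuple !permKV ab => <-.
  split=> a b ab; last first.
    rewrite (mem_comp_set_co _ ab) => ba.
    have /lt_s : (a < b)%N by rewrite ab.
    by rewrite ltnNge (ltnW ba) andbF orbF.
  move: ab; rewrite leq_eqVlt => /orP[/eqP/val_inj->//|/lt_s].
  by case/orP=> [/ltW//|/andP[/eqP->]].
(* At the positions [w j < w k] of [s], the tie-break by [w^-1] becomes [j < k], as in [std_ltE]. *)
apply: eq_perm_homo => j k /(L_words_lt sL).
by rewrite !permK std_ltE !tnth_mktuple.
Qed.

Lemma prod_word_act (R : realType) d (I : orderType d) n (w : 'S_n) (x : I -> R) t :
  \prod_(k < n) x (tnth (word_act w t) k) = \prod_(k < n) x (tnth t k).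
Proof.
rewrite [RHS](reindex_inj (@perm_inj _ w)) /=.
by apply: eq_bigr => k _; rewrite tnth_mktuple.
Qed.

Lemma QS_Lsum (R : realType) d (I : orderType d) n (x : I -> R) (w : 'S_n) :
  QS x w = Lsum (co w^-1) x.
Proof.
rewrite /QS (@reindex_esum R _ _ (L_words I (co w^-1)) _ (word_act w)); last first.
  split=> [s /std_L_words//|s s' _ _|t tw].
    exact: (can_inj (@word_actK _ _ _ w)).
  exists (word_act w^-1 t); rewrite ?word_actKV //.
  by apply/std_L_words; rewrite word_actKV.
by apply: eq_esum => s _; rewrite prod_word_act.
Qed.

(** * Product words over [I *l J] *)

Section ConvolutionWords.
Variables (dI : Order.disp_t) (I : orderType dI) (dJ : Order.disp_t).
Variables (J : orderType dJ) (n : nat).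

(** Plain pairing of the two words would be a bijection as well; permuting the first by [std q.2] is
    what makes [std] multiplicative. *)
Definition word_mul (q : n.-tuple I * n.-tuple J) : n.-tuple (I *l J) :=
  [tuple (tnth q.1 (std q.2 k), tnth q.2 k) | k < n].

Lemma std_word_mul q : std (word_mul q) = pmul (std q.1) (std q.2).
Proof.
apply: eq_perm_homo => j k; rewrite !pmulE std_ltE => jk.
rewrite std_ltE !tnth_mktuple Order.ProdLexiOrder.ltEprodlexi /= xpair_eqE.
case/orP: jk => [jk|/andP[/eqP->]]; first by rewrite (ltW jk) /= leNgt jk.
(* On a tie of first coordinates, comparing [std q.2] amounts to comparing second letters, then
   positions. *)
by rewrite lexx eqxx std_ltE.
Qed.

Lemma word_mul_bij : bijective word_mul.
Proof.
pose snds (t : n.-tuple (I *l J)) : n.-tuple J := [tuple (tnth t k).2 | k < n].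
pose fsts (t : n.-tuple (I *l J)) : n.-tuple I := [tuple (tnth t k).1 | k < n].
have sndsK q : snds (word_mul q) = q.2.
  by apply: eq_from_tnth => k; rewrite !tnth_mktuple.
(* The second coordinates return [q.2], hence [std q.2], whose inverse restores [q.1]. *)
exists (fun t => (word_act (std (snds t))^-1 (fsts t), snds t)) => [q|t].
  rewrite sndsK; case: q => a b /=; congr pair.
  by apply: eq_from_tnth => k; rewrite !tnth_mktuple permKV.
apply: eq_from_tnth => k.
by rewrite !tnth_mktuple /= permK [tnth _ k in RHS]surjective_pairing.
Qed.

End ConvolutionWords.

(** * Nonnegative extended sums and total mass *)

Local Open Scope ereal_scope.

Lemma esumZl (R : realType) (T : choiceType) (A : set T) (r : R) (f : T -> \bar R) :
  (0 <= r)%R -> (forall i, 0 <= f i) ->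
  \esum_(i in A) (r%:E * f i) = r%:E * \esum_(i in A) f i.
Proof.
move=> r0 f0; rewrite /esum -ereal_supZl //; last first.
  (* The supremum scales over a nonempty set of partial sums; the empty sum is one. *)
  apply/set0P; exists 0; exists set0; first exact: fsets_set0.
  by rewrite fsbig_set0.
congr ereal_sup; apply/seteqP; split => [_ [F [finF FA] <-]|_ [_ [F [finF FA] <-] <-]].
  exists (\sum_(i \in F) f i); first by exists F.
  by rewrite ge0_mule_fsumr.
exists F => //.
by rewrite ge0_mule_fsumr.
Qed.

(** Tonelli, after which each factor is pulled out as a real scalar; finiteness of the [g]-sum makes
    it one. *)
Lemma esumM (R : realType) (S T : choiceType) (A : set S) (B : set T)
    (f : S -> R) (g : T -> R) :
  (forall i, (0 <= f i)%R) -> (forall j, (0 <= g j)%R) ->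
  \esum_(j in B) (g j)%:E \is a fin_num ->
  \esum_(p in A `*` B) (f p.1 * g p.2)%:E =
  (\esum_(i in A) (f i)%:E) * \esum_(j in B) (g j)%:E.
Proof.
move=> f0 g0 gfin; have -> : A `*` B = A `*`` (fun=> B) by [].
rewrite -(@esum_esum _ _ _ A (fun=> B) (fun i j => (f i * g j)%:E)); last first.
  by move=> i j _ _; rewrite lee_fin mulr_ge0.
rewrite -(fineK gfin) muleC -esumZl; last 2 first.
- by rewrite fine_ge0 // esum_ge0 // => j _; rewrite lee_fin.
- by move=> i; rewrite lee_fin.
apply: eq_esum => i _; rewrite muleC fineK //.
by rewrite -esumZl.
Qed.

(** Splitting off the first letter multiplies the mass for length [n] by the total mass of [x]. *)
Lemma esum_tuple_prod (R : realType) (I : choiceType) (x : I -> R) n :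
  prob_distr x ->
  \esum_(t in [set: n.-tuple I]) (\prod_(k < n) x (tnth t k))%:E = 1.
Proof.
move=> [x0 x1]; elim: n => [|n IH].
  rewrite (_ : [set: 0.-tuple I] = [set [tuple]]).
    by rewrite esum_set1 big_ord0.
  by apply/seteqP; split=> t // _; rewrite /= tuple0.
rewrite (@reindex_esum R _ _ ([set: I] `*` [set: n.-tuple I]) _
  (fun p => [tuple of p.1 :: p.2])); last first.
  split=> // [[i s] [j t] _ _ /(congr1 val) [-> st]|t _].
    by congr pair; apply: val_inj.
  by exists (thead t, [tuple of behead t]) => //; rewrite -tuple_eta.
under eq_esum => p _.
  rewrite big_ord_recl tnth0.
  under eq_bigr do rewrite tnthS.
  over.
rewrite (@esumM _ _ _ _ _ x (fun t : n.-tuple I => \prod_(k < n) x (tnth t k))%R) //.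
- by rewrite x1 IH mule1.
- by move=> t; rewrite prodr_ge0.
- by rewrite IH.
Qed.

Lemma QS_fin_num (R : realType) d (I : orderType d) n (x : I -> R) (w : 'S_n) :
  prob_distr x -> QS x w \is a fin_num.
Proof.
move=> hx; have x0 (t : n.-tuple I) : (0 <= \prod_(k < n) x (tnth t k))%R.
  by rewrite prodr_ge0 // => k _; case: hx.
rewrite ge0_fin_numE; last by apply: esum_ge0 => t _; rewrite lee_fin.
apply: (@le_lt_trans _ _ 1); last exact: ltry.
rewrite -(esum_tuple_prod n hx) /QS esum_mkcond; apply: le_esum => t _.
by case: ifP => // _; rewrite lee_fin.
Qed.

Lemma fsbig_finType (R : Type) (idx : R) (op : Monoid.com_law idx)
    (T : finType) (P : pred T) (f : T -> R) :
  \big[op/idx]_(i \in [set i | P i]) f i = \big[op/idx]_(i | P i) f i.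
Proof.
rewrite -[RHS]big_filter [RHS]fsbig_seq ?filter_uniq ?index_enum_uniq //.
apply: eq_fsbigl; apply/seteqP.
by split=> i /=; rewrite mem_filter mem_index_enum andbT.
Qed.

(** The fibers of [h] partition the index set; the double sum is reindexed along the graph of
    [h]. *)
Lemma esum_fibers (R : realType) (T : choiceType) (K : finType) (h : T -> K)
    (P : pred K) (a : T -> \bar R) : (forall i, 0 <= a i) ->
  \esum_(i in [set i | P (h i)]) a i =
  \sum_(k | P k) \esum_(i in [set i | h i = k]) a i.
Proof.
move=> a0; rewrite -fsbig_finType -esum_fset; last 2 first.
- exact: finite_finset.
- by move=> k _; exact: esum_ge0.
rewrite esum_esum //= (@reindex_esum R _ _ [set i | P (h i)] _ (fun i => (h i, i))) //.
split=> [i Pi //=|i j _ _ [_ ->//]|[k i] /= [Pk hi]].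
by exists i => //=; rewrite hi.
Qed.

(** * Convolution and the law of a product *)

Lemma perm_conv_QS (R : realType) (dI : Order.disp_t) (I : orderType dI)
    (dJ : Order.disp_t) (J : orderType dJ) n (x : I -> R) (y : J -> R) (w : 'S_n) :
  prob_distr x -> prob_distr y ->
  perm_conv (QS x) (QS y) w = QS (distr_mul x y) w.
Proof.
move=> hx hy.
have X0 (t : n.-tuple I) : (0 <= \prod_(k < n) x (tnth t k))%R.
  by rewrite prodr_ge0 // => k _; case: hx.
have Y0 (t : n.-tuple J) : (0 <= \prod_(k < n) y (tnth t k))%R.
  by rewrite prodr_ge0 // => k _; case: hy.
pose F (q : n.-tuple I * n.-tuple J) : \bar R :=
  (\prod_(k < n) x (tnth q.1 k) * \prod_(k < n) y (tnth q.2 k))%:E.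
(* Both sides weigh the pairs of words whose standardizations multiply to [w]. For fixed
   standardizations [(u, v)] these pairs form a product set, so their sum factors as
   [QS x u * QS y v]. *)
transitivity (\esum_(q in [set q | pmul (std q.1) (std q.2) == w]) F q).
  rewrite (esum_fibers (fun q => (std q.1, std q.2)) (fun p => pmul p.1 p.2 == w)).
    apply: eq_bigr => -[u v] _; rewrite -(esumM _ X0 Y0) ?QS_fin_num //.
    by congr esum; apply/seteqP; split=> q /= [-> ->].
  by move=> q; rewrite lee_fin mulr_ge0.
rewrite /QS (@reindex_esum R _ _ [set q | pmul (std q.1) (std q.2) == w]
  _ (@word_mul _ I _ J n)); last first.
  have [e eK Ke] := @word_mul_bij _ I _ J n.
  split=> [q /eqP qw /=|q q' _ _ /(can_inj eK)//|t /= tw].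
    by rewrite std_word_mul.
  by exists (e t); rewrite /= -?std_word_mul ?Ke ?tw.
apply: eq_esum => q _; rewrite /F; congr EFin.
(* [word_mul] only permutes the letters of [q.1], which leaves their weight unchanged. *)
rewrite -[X in (X * _)%R](prod_word_act (std q.2)) -big_split /=.
by apply: eq_bigr => k _; rewrite /distr_mul !tnth_mktuple.
Qed.

(** The event is a finite disjoint union over the factorizations of [w], and independence factors
    the probability of each piece. *)
Lemma law_pmul (R : realType) (d : measure_display) (T : measurableType d)
    (P : probability T R) n (U V : T -> 'S_n) (f g : 'S_n -> \bar R) :
  random_perm U -> random_perm V -> has_law P U f -> has_law P V g ->
  independent_perms P U V ->
  has_law P (fun t => pmul (U t) (V t)) (perm_conv f g).
Proof.
move=> mU mV Uf Vg UV w.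
rewrite (_ : _ @^-1` _ = \bigcup_(p in [set p | pmul p.1 p.2 == w])
   (U @^-1` [set p.1] `&` V @^-1` [set p.2])); last first.
  apply/seteqP; split=> t /= => [tw|[p /eqP <- [-> ->]]//].
  by exists (U t, V t) => //=; rewrite tw.
rewrite measure_fin_bigcup; last 3 first.
- exact: finite_finset.
- by move=> [u v] [u' v'] _ _ [t [[/= <- <-] [/= <- <-]]].
- by move=> p _; apply: measurableI; [exact: mU|exact: mV].
rewrite fsbig_finType; apply: eq_bigr => p _.
by rewrite -Uf -Vg; exact: UV.
Qed.

Local Close Scope ereal_scope.

(** * Passage to the group algebra *)

Lemma GammaE (R : realType) d (I : orderType d) n (x : I -> R) w :
  Gamma n x w = fine (QS x w).
Proof.
rewrite /Gamma (big_morph (fun f : galg R n => f w) (id1 := 0) (op1 := +%R));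
  last 2 first.
- by move=> f g; rewrite ffunE.
- by rewrite ffunE.
rewrite (bigD1 w) //= big1 => [|v /negPf vw].
  by rewrite addr0 QS_Lsum !ffunE eqxx [_ *: _]mulr1.
by rewrite !ffunE eq_sym vw [_ *: _]mulr0.
Qed.

Lemma Gamma_mul (R : realType) (dI : Order.disp_t) (I : orderType dI)
    (dJ : Order.disp_t) (J : orderType dJ) n (x : I -> R) (y : J -> R) :
  prob_distr x -> prob_distr y -> Gamma n x * Gamma n y = Gamma n (distr_mul x y).
Proof.
move=> hx hy; apply/ffunP => w; rewrite GammaE -perm_conv_QS //.
(* Finiteness of the [QS] values lets [fine] commute with the sum and the products. *)
rewrite [LHS]ffunE -sum_fine => [|p _]; last by rewrite fin_numM // QS_fin_num.
by apply: eq_bigr => p _; rewrite !GammaE fineM // QS_fin_num.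
Qed.

Unset Implicit Arguments.
Set Strict Implicit.

Theorem theorem2p4 (R : realType) (n : nat) (hn : (1 <= n)%N)
    (dI : Order.disp_t) (I : orderType dI) (dJ : Order.disp_t) (J : orderType dJ)
    (x : I -> R) (y : J -> R) (hx : prob_distr x) (hy : prob_distr y) :
  [/\ (forall (dT : measure_display) (T : measurableType dT)
          (P : probability T R) (U V : T -> 'S_n),
          random_perm U -> random_perm V ->
          has_law P U (QS x) -> has_law P V (QS y) -> independent_perms P U V ->
          forall w : 'S_n,
            P [set t | pmul (U t) (V t) = w]
              = Lsum (co (w^-1)%g) (distr_mul x y)),
      (forall w : 'S_n,
         perm_conv (QS x) (QS y) w = QS (distr_mul x y) w)
    & Gamma n x * Gamma n y = Gamma n (distr_mul x y)].
Proof.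
split=> [dT T P U V mU mV Ux Vy UV w|w|].
- by rewrite -QS_Lsum -perm_conv_QS //; exact: (law_pmul mU mV Ux Vy UV w).
- exact: perm_conv_QS.
- exact: Gamma_mul.
Qed.
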